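(* Let $G$ be a countably infinite group with identity $e$ such that for each $g\in G\setminus\{e\}$ the set $\{x\in G:x^2=g\}$ is finite. Then for any $X_0\subseteq G$ with $X_0=X_0^{-1}$ and $e\in X_0$, there exists a sequence $(X_n)_{n\in\omega}$ of subsets of $G$ (starting with the given $X_0$) such that $\Delta(X_{n+1})=X_n$ for all $n\in\omega$ and $X_m\cap X_n=\{e\}$ whenever $0<m<n<\omega$.
   Context: For $X\subseteq G$, $\Delta(X)=\{g\in G:|gX\cap X|=\infty\}$. *)

(* Defs.v *)
From mathcomp Require Import all_boot.
From mathcomp Require Import all_classical.

Set Implicit Arguments.
Unset Strict Implicit.
Unset Printing Implicit Defensive.

Local Open Scope group_scope.
Local Open Scope classical_set_scope.

Definition Delta (G : groupType) (X : set G) : set G :=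
  [set g | infinite_set ([set g * x | x in X] `&` X)].

(* Main.v *)
Require Import Defs.
From mathcomp Require Import all_boot.
From mathcomp Require Import all_classical.

Set Implicit Arguments.
Unset Strict Implicit.
Unset Printing Implicit Defensive.

Local Open Scope card_scope.
Local Open Scope group_scope.
Local Open Scope classical_set_scope.

(** All the sets [X_(n+1)] are built simultaneously in countably many stages.
Every pair [(n, a)] is scheduled infinitely often; at a stage devoted to [(n, a)],
if [a] already lies in [X_n] (otherwise [a] is replaced by [1]), a generic [x] is
chosen and the block [{x, ax, x^-1, (ax)^-1}] is thrown into [X_(n+1)].  The
quotient [(ax)x^-1 = a] then occurs infinitely often in [X_(n+1)].  Genericity
means that at stage [k] the block meets nothing used before (in any layer), and
that among the first [k] elements of [G] the only new quotients are [1], [a],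
[a^-1].  This is possible: the quotients [x^2], [ax^2], [xax], [(ax)^2] take a
given value infinitely often only if that value is [1], [a], [a^-1], [1]
respectively, by finiteness of square roots; the conjugates [x^-1 a x] either
avoid a given finite set for infinitely many [x], or [a] has an infinite
centralizer, in which [x] can be chosen. *)

Definition block (G : groupType) (a x : G) : seq G :=
  [:: x; a * x; x^-1; (a * x)^-1].

Lemma block_inv (G : groupType) (a x s : G) :
  s \in block a x -> s^-1 \in block a x.
Proof.
by rewrite !inE => /or4P[] /eqP ->; rewrite ?invgK eqxx ?orbT.
Qed.

Lemma finite_sqr_preimage (G : groupType) (F : set G) :
  (forall g : G, g <> 1 -> finite_set [set x : G | x ^+ 2 = g]) ->
  finite_set F -> finite_set [set x : G | F (x * x) /\ x * x <> 1].
Proof.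
move=> fsqrt finF.
apply: (@sub_finite_set _ _ (\bigcup_(g in F `\ 1) [set x | x ^+ 2 = g])).
  by move=> x [Fx x1]; exists (x * x).
by apply: bigcup_finite => [|g [_ g1]]; [exact: finite_setD | exact: fsqrt].
Qed.

(* If the set were finite, so would be the centralizer of [a], hence each fibre of
   [x |-> a ^ x]; finitely many fibres would then cover almost all of [G]. *)
Lemma infinite_conj_fixed_or_notin (G : groupType) (a : G) (F : set G) :
  infinite_set [set: G] -> finite_set F ->
  infinite_set [set x : G | F (a ^ x) -> a ^ x = a].
Proof.
move=> infG finF finC; apply: infG.
suff fib g : finite_set [set x | a ^ x = g].
  apply: (@sub_finite_set _ _ ([set x : G | F (a ^ x) -> a ^ x = a] `|`
    \bigcup_(g in F) [set x | a ^ x = g])).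
    move=> x _; have [Fx|nFx] := pselect (F (a ^ x)).
      by right; exists (a ^ x).
    by left=> /nFx.
  by rewrite finite_setU; split=> //; exact: bigcup_finite.
have [->|/set0P[y /= ay]] := eqVneq [set x | a ^ x = g] set0 => //.
apply: (@sub_finite_set _ _ ( *%g^~ y @` [set x : G | F (a ^ x) -> a ^ x = a])).
  move=> x /= ax; exists (x * y^-1); last by rewrite mulgVK.
  by rewrite conjgM ax -ay conjgK.
exact: finite_image.
Qed.

Lemma exists_generic_block (G : groupType) (a : G) (F K : set G) :
  infinite_set [set: G] ->
  (forall g : G, g <> 1 -> finite_set [set x : G | x ^+ 2 = g]) ->
  finite_set F -> finite_set K -> (forall g, F g -> F g^-1) ->
  exists x, (forall s, s \in block a x -> ~ K s) /\
    forall s t, s \in block a x -> t \in block a x -> F (s * t) ->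
      s * t \in [:: 1; a; a^-1].
Proof.
move=> infG fsqrt finF finK FV.
pose sq (H : set G) := [set x : G | H (x * x) /\ x * x <> 1].
have finpre (f : G -> G) (H : set G) :
    injective f -> finite_set H -> finite_set (f @^-1` H).
  by move=> fI; apply: finite_preimage => x y _ _; exact: fI.
have axI : injective ( *%g a) by exact: mulgI.
have axVI : injective (fun x => (a * x)^-1) by move=> x y /invg_inj/mulgI.
have finsq H : finite_set H -> finite_set (sq H) by exact: finite_sqr_preimage.
(* The twisted square terms of [E] rule out [a x^2] and, via
   [x a x = a^-1 (a x)^2], the product [x a x]. *)
pose E := K `|` ( *%g a @^-1` K) `|` ((fun x : G => x^-1) @^-1` K) `|`
  ((fun x => (a * x)^-1) @^-1` K) `|` sq F `|` sq ( *%g a @^-1` F) `|`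
  ( *%g a @^-1` sq F) `|` ( *%g a @^-1` (sq ( *%g a^-1 @^-1` F))).
have finE : finite_set E.
  have invI : injective (fun x : G => x^-1) by exact: invg_inj.
  have aVI : injective ( *%g a^-1) by exact: mulgI.
  have fU (A B : set G) : finite_set A -> finite_set B -> finite_set (A `|` B).
    by move=> fA fB; rewrite finite_setU.
  apply: (fU); last exact/(finpre _ _ axI)/finsq/(finpre _ _ aVI).
  apply: (fU); last exact/(finpre _ _ axI)/finsq.
  apply: (fU); last exact/finsq/(finpre _ _ axI).
  apply: (fU); last exact/finsq.
  apply: (fU); last exact/(finpre _ _ axVI).
  apply: (fU); last exact/(finpre _ _ invI).
  by apply: (fU); last exact/(finpre _ _ axI).
have /infinite_setN0[x [/= Cx nEx]] :=
  infinite_setD (infinite_conj_fixed_or_notin (a := a) infG finF) finE.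
have {nEx}[[[[[[[nK1 nK2] nK3] nK4] nxx] naxx] naxax] nxax] :
  (((((((~ K x /\ ~ K (a * x)) /\ ~ K x^-1) /\ ~ K (a * x)^-1) /\ ~ sq F x) /\
   ~ sq ( *%g a @^-1` F) x) /\ ~ sq F (a * x)) /\
   ~ sq ( *%g a^-1 @^-1` F) (a * x)).
  by rewrite -!not_orP.
exists x; split=> [s|].
  by rewrite !inE => /or4P[] /eqP ->.
pose P g := F g -> g \in [:: 1; a; a^-1].
have PV g : P g -> P g^-1.
  rewrite /P !inE => Pg /FV; rewrite invgK => /Pg /or3P[] /eqP ->;
  by rewrite ?invg1 ?invgK eqxx ?orbT.
have P1 : P 1 by move=> _; rewrite !inE eqxx.
have Pa : P a by move=> _; rewrite !inE eqxx orbT.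
have Pxx : P (x * x).
  move=> Fx; have [->|/eqP x1] := eqVneq (x * x) 1; last by case: nxx.
  by rewrite !inE eqxx.
have Paxx : P (a * x * x).
  move=> Fx; have [x1|/eqP x1] := eqVneq (x * x) 1.
    by rewrite -mulgA x1 mulg1 !inE eqxx orbT.
  by case: naxx; split=> //=; rewrite mulgA.
have Paxax : P (a * x * (a * x)).
  move=> Fx; have [->|/eqP x1] := eqVneq (a * x * (a * x)) 1; last by case: naxax.
  by rewrite !inE eqxx.
have Pxax : P (x * (a * x)).
  move=> Fx; have [x1|/eqP x1] := eqVneq (a * x * (a * x)) 1; last first.
    by case: nxax; split=> //=; rewrite -mulgA mulKg.
  have -> : x * (a * x) = a^-1 by apply: (mulgI a); rewrite mulgV mulgA.
  by rewrite !inE eqxx !orbT.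
have Pconj : P (x^-1 * (a * x)).
  by rewrite -conjgE => Fx; rewrite (Cx Fx) !inE eqxx orbT.
suff: forall s t, s \in block a x -> t \in block a x -> P (s * t) by [].
(* Inversion turns [s * t] into [t^-1 * s^-1], again a product of two block elements. Hence every
   product not treated above is the inverse of one that is, or collapses to [1], [a] or [a^-1]. *)
have Pm s t : P (t^-1 * s^-1) -> P (s * t).
  by move=> /PV; rewrite invgM !invgK.
move=> s t; rewrite !inE => /or4P[] /eqP -> /or4P[] /eqP -> //;
  rewrite ?mulgV ?mulVg ?mulgK //.
all: apply: Pm; rewrite ?invgK //.
all: by rewrite ?mulgK.
Qed.

(** [F] holds the quotients to be controlled, [L] the elements already used. Products can stand for
    quotients because blocks are closed under inversion. *)
Definition generic (G : groupType) (F L : set G) (a x : G) :=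
  [/\ forall s, s \in block a x -> ~ L s,
      forall s t, s \in block a x -> L t -> ~ F (s * t) /\ ~ F (t * s)
    & forall s t, s \in block a x -> t \in block a x -> F (s * t) ->
        s * t \in [:: 1; a; a^-1]].

Lemma exists_generic_extension (G : groupType) (a : G) (F L : set G) :
  infinite_set [set: G] ->
  (forall g : G, g <> 1 -> finite_set [set x : G | x ^+ 2 = g]) ->
  finite_set F -> finite_set L -> exists x, generic F L a x.
Proof.
move=> infG fsqrt finF finL.
pose F' := F `|` [set f^-1 | f in F].
have F'V g : F' g -> F' g^-1.
  by move=> [Fg|[f Ff <-]]; [right; exists g | left; rewrite invgK].
have finF' : finite_set F'.
  by rewrite finite_setU; split=> //; exact: finite_image.
(* For [t] in [L] and [f] in [F], the added elements are the solutions [s] of [t * s = f] and of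
   [s * t = f]. *)
pose K := L `|` [set t^-1 * f | t in L & f in F] `|`
  [set f * t^-1 | f in F & t in L].
have finK : finite_set K.
  by rewrite !finite_setU; do !split=> //; exact: finite_image2.
have [x [nK FB]] := exists_generic_block a infG fsqrt finF' finK F'V.
exists x; split=> [s /nK nKs Ls|s t /nK nKs Lt|s t sB tB Fst].
- by apply: nKs; left; left.
- split=> Fst; apply: nKs.
    by right; exists (s * t) => //; exists t => //; rewrite mulgK.
  by left; right; exists t => //; exists (t * s) => //; rewrite mulKg.
- by apply: FB => //; left.
Qed.

(** Feeding a choice function with the list of its earlier values lets each stage depend on
    everything built before it. *)
Lemma prefix_choice (T : Type) (P : seq T -> T -> Prop) :
  (forall s, exists t, P s t) -> exists f, forall k, P (mkseq f k) (f k).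
Proof.
move=> /choice[c cP].
pose hist := fix hist k := if k is j.+1 then rcons (hist j) (c (hist j))
  else [::].
exists (fun k => c (hist k)) => k.
suff -> : mkseq (fun k => c (hist k)) k = hist k by [].
by elim: k => // k IH; rewrite mkseqS IH.
Qed.

Lemma infinitely_often_enumeration (T : Type) (e : nat -> T) :
  (forall t, exists i, e i = t) ->
  exists sigma : nat -> nat * T, forall p, infinite_set [set k | sigma k = p].
Proof.
move=> e_surj.
(* The third coordinate is a dummy that gives every pair infinitely many codes. *)
exists (fun k => if (unpickle k : option (nat * nat * nat)) is Some (n, i, _)
  then (n, e i) else (0, e 0)).
move=> [n t] fin; have [i eit] := e_surj t.
apply: infinite_nat.
have r_inj : injective (fun r : nat => pickle (n, i, r)).
  by move=> r r' /(pcan_inj pickleK)[].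
have := finite_preimage (fun r r' _ _ => r_inj r r') fin.
by apply: sub_finite_set => r _ /=; rewrite pickleK eit.
Qed.

(** [1] counts as used since it lies in every layer; genericity against it also keeps new blocks
    away from [F] itself. *)
Definition used (G : groupType) (s : seq (nat * G * G)) : seq G :=
  1 :: flatten [seq block e.1.2 e.2 | e <- s].

(* An entry [(n, a, x)] puts [block a x] into the set of index [n.+1]. *)
Definition layer (G : groupType) (X0 : set G) (E : set (nat * G * G)) (n : nat) :
    set G :=
  if n is m.+1 then
    [set y | y = 1 \/ exists e, [/\ E e, e.1.1 = m & y \in block e.1.2 e.2]]
  else X0.

Lemma layer1 (G : groupType) (X0 : set G) E n : X0 1 -> layer X0 E n 1.
Proof. by case: n => //= n _; left. Qed.

Lemma layer_inv (G : groupType) (X0 : set G) E n g :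
  X0 = [set x^-1 | x in X0] -> layer X0 E n g -> layer X0 E n g^-1.
Proof.
case: n => [X0V /= X0g|n _ /= [->|[e [Ee en ge]]]].
- by rewrite X0V; exists g.
- by left; rewrite invg1.
- by right; exists e; split=> //; exact: block_inv.
Qed.

Lemma layerS (G : groupType) (X0 : set G) E E' n :
  E `<=` E' -> layer X0 E n `<=` layer X0 E' n.
Proof.
move=> EE'; case: n => [|n] y //= [->|[e [Ee en ye]]]; first by left.
by right; exists e; split=> //; exact: EE'.
Qed.

(** Membership is tested in the layers of the prefix [s], the final ones being still unknown. Layers
    only grow, so each element is eventually recognised. *)
Definition stage (G : groupType) (X0 : set G) (F : nat -> set G)
    (sigma : nat -> nat * G) (s : seq (nat * G * G)) (e : nat * G * G) :=
  [/\ e.1.1 = (sigma (size s)).1,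
      layer X0 [set` s] e.1.1 e.1.2,
      layer X0 [set` s] e.1.1 (sigma (size s)).2 -> e.1.2 = (sigma (size s)).2
    & generic (F (size s)) [set` used s] e.1.2 e.2].

Lemma exists_stage (G : groupType) (X0 : set G) (F : nat -> set G)
    (sigma : nat -> nat * G) (s : seq (nat * G * G)) :
  infinite_set [set: G] ->
  (forall g : G, g <> 1 -> finite_set [set x : G | x ^+ 2 = g]) ->
  X0 1 -> (forall k, finite_set (F k)) -> exists e, stage X0 F sigma s e.
Proof.
move=> infG fsqrt X01 finF; case sigmaE: (sigma (size s)) => [n g].
have [a [la ag]] : exists a, layer X0 [set` s] n a /\
    (layer X0 [set` s] n g -> a = g).
  have [lg|nlg] := pselect (layer X0 [set` s] n g); first by exists g.
  by exists 1; split=> //; exact: layer1.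
have [x gx] := exists_generic_extension a infG fsqrt (finF (size s))
  (finite_seq (used s)).
by exists (n, a, x); rewrite /stage sigmaE.
Qed.

Theorem theorem5p4 (G : groupType)
  (G_countably_infinite : [set: G] #= [set: nat])
  (finite_square_roots :
     forall g : G, g <> 1 -> finite_set [set x : G | x ^+ 2 = g])
  (X0 : set G)
  (X0_sym : X0 = [set x^-1 | x in X0])
  (X0_1 : X0 1) :
  exists X : nat -> set G,
    [/\ X 0 = X0,
        forall n : nat, Delta (X n.+1) = X n
      & forall m n : nat, (0 < m)%N -> (m < n)%N -> X m `&` X n = [set 1]].
Proof.
have infG : infinite_set [set: G].
  by rewrite (eq_finite_set G_countably_infinite); exact: infinite_nat.
have [e e_surj] : exists e : nat -> G, forall g, exists i, e i = g.
  have /card_set_bijP[f [_ f_inj _]] := G_countably_infinite.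
  exists (fun i => xget 1 [set g | f g = i]) => g; exists (f g).
  have fg : f (xget 1 [set h | f h = f g]) = f g.
    by apply: (xgetPex 1 (P := [set h | f h = f g])); exists g.
  by apply: f_inj; rewrite ?inE.
have [sigma sigma_inf] := infinitely_often_enumeration e_surj.
(* The bound [k.+1] puts [e i] into [F k] from stage [i] on. *)
pose F k := [set e i | i in `I_k.+1].
have finF k : finite_set (F k) by apply: finite_image; exact: finite_II.
have [f fP] := prefix_choice (fun s =>
  exists_stage sigma s infG finite_square_roots X0_1 finF).
pose B k := block (f k).1.2 (f k).2.
pose U k := used (mkseq f k).
have UP k y : y \in U k <-> y = 1 \/ exists2 j, (j < k)%N & y \in B j.
  rewrite /U /used inE; split.
    case/orP=> [/eqP|/flatten_mapP[_ /mapP[j + ->] yB]]; first by left.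
    by rewrite mem_iota => jk; right; exists j.
  case=> [->|[j jk yB]]; first by rewrite eqxx.
  apply/orP; right; apply/flatten_mapP; exists (f j) => //.
  by apply: map_f; rewrite mem_iota.
have gen k : generic (F k) [set` U k] (f k).1.2 (f k).2.
  by have [_ _ _] := fP k; rewrite size_mkseq.
have level k : (f k).1.1 = (sigma k).1 by have [] := fP k; rewrite size_mkseq.
(* Blocks of distinct stages are disjoint, whatever their layers, because the later one avoids
   everything used. *)
have B_inj j k y : y \in B j -> y \in B k -> j = k.
  wlog jk : j k / (j < k)%N.
    by move=> W yj yk; have [jk|kj|//] := ltngtP j k; [|apply/esym]; exact: W.
  move=> yj yk; have [/(_ y yk) nU _ _] := gen k; exfalso; apply: nU => /=.
  by apply/UP; right; exists j.
pose X := layer X0 (range f).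
have X1 n : X n 1 by exact: layer1.
have XV n g : X n g -> X n g^-1 by exact: layer_inv.
have XSP n y : X n.+1 y <-> y = 1 \/ exists k, (f k).1.1 = n /\ y \in B k.
  split=> [[->|[_ [[k _ <-] kn yB]]]|[->|[k [kn yB]]]]; [by left| |by left|].
    by right; exists k.
  by right; exists (f k); split=> //; exists k.
have Xa k : X (f k).1.1 (f k).1.2.
  have [_ la _ _] := fP k; apply: layerS la => _ /= /mapP[j _ ->].
  by exists j.
have X_stable n y : X n y ->
    exists N, forall k, (N <= k)%N -> layer X0 [set` mkseq f k] n y.
  case: n => [Xy|n /XSP[->|[j [jn yB]]]]; first by exists 0.
    by exists 0 => k _; left.
  exists j.+1 => k jk; right; exists (f j); split=> //=.
  by apply: map_f; rewrite mem_iota.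
exists X; split=> // [n|m n].
- apply/seteqP; split=> g /=.
  + rewrite /Delta /= => infg; apply: contrapT => nXg; apply: infg.
    have [i eig] := e_surj g.
    have Fg k : (i <= k)%N -> F k g by move=> ik; exists i.
    (* For [g = e i] outside [X n], all points of the intersection were used before stage [i]. *)
    apply: sub_finite_set (finite_seq (U i)) => y [[z Xz gzy] Xy] /=.
    have gE : g = y * z^-1 by rewrite -gzy mulgK.
    apply: contrapT => nUy.
    have [k [kn yB]] : exists k, (f k).1.1 = n /\ y \in B k.
      by move/XSP: Xy => [y1|//]; case: nUy; apply/UP; left.
    have ik : (i <= k)%N.
      by rewrite leqNgt; apply/negP => ki; apply: nUy; apply/UP; right; exists k.
    have [_ genk genkk] := gen k.
    move/XSP: Xz => [z1|[j [jn /block_inv zB]]].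
      have [|+ _] := genk y 1 yB; first by apply/UP; left.
      by apply; rewrite mulg1; move: gE; rewrite z1 invg1 mulg1 => <-; exact: Fg.
    (* Genericity at the later of the two stages excludes [g = y * z^-1]. Within a single stage, [g]
       is [1], [a] or [a^-1], all of which lie in [X n]. *)
    have [jk|kj|jk] := ltngtP j k.
    * have [|+ _] := genk y z^-1 yB; first by apply/UP; right; exists j.
      by apply; rewrite -gE; exact: Fg.
    * have [_ /(_ z^-1 y zB) genj _] := gen j.
      have [|_] := genj; first by apply/UP; right; exists k.
      by apply; rewrite -gE; apply: Fg; exact: leq_trans (ltnW kj).
    * rewrite jk in zB; have := genkk y z^-1 yB zB; rewrite -gE => /(_ (Fg k ik)).
      rewrite !inE => /or3P[] /eqP gE'; apply: nXg; rewrite gE' // -kn //.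
      exact: XV.
  + move=> Xg finD; have [N NP] := X_stable n g Xg.
    apply: (infinite_setD (sigma_inf (n, g)) (finite_II N)).
    (* Each late stage devoted to [(n, g)] contributes a common point [g * x]. These points are
       distinct by disjointness of blocks, so a finite intersection would leave only finitely many
       such stages. *)
    have h_inj : {in (fun k => (f k).1.2 * (f k).2) @^-1`
        ([set g * x | x in X n.+1] `&` X n.+1) &,
        injective (fun k => (f k).1.2 * (f k).2)}.
      move=> j k _ _ jk; apply: (B_inj _ _ ((f j).1.2 * (f j).2)).
        by rewrite !inE eqxx orbT.
      by rewrite jk !inE eqxx orbT.
    apply: sub_finite_set (finite_preimage h_inj finD) => k [/= sk /negP].
    rewrite -leqNgt => Nk; have [_ _ + _] := fP k.
    have kn : (f k).1.1 = n by rewrite level sk.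
    rewrite size_mkseq sk kn /= => /(_ (NP k Nk)) ak.
    split; last by apply/XSP; right; exists k; rewrite !inE eqxx orbT.
    exists (f k).2; last by rewrite ak.
    by apply/XSP; right; exists k; rewrite inE eqxx.
(* A common point other than [1] lies in a single block, which belongs to a single layer. *)
- case: m => // m _; case: n => // n mn; apply/seteqP; split=> y /=; last first.
    by move->; split; [exact: (X1 m.+1) | exact: (X1 n.+1)].
  case=> /XSP[//|[j [jm yj]]] /XSP[//|[k [kn yk]]].
  by move: mn; rewrite -jm -kn (B_inj _ _ _ yj yk) ltnn.
Qed.
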